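(* Let $\mu\in(0,\tfrac12]$, $m_3>0$, $c<0$, $v=(1-3m_3^{2/3}c)^{-1/3}$, and $$\lambda_1=\tfrac32\left(1-\sqrt{1-v^2(4-v^2)(\mu-\mu^2)}\right),\qquad \lambda_2=\tfrac32\left(1+\sqrt{1-v^2(4-v^2)(\mu-\mu^2)}\right).$$ Consider the Hill four-body problem with oblate tertiary, with effective potential $\Omega$ on $\mathbb R^3\setminus\{0\}$ given in the context. All its equilibrium points, i.e. the solutions of $\Omega_x=\Omega_y=\Omega_z=0$, lie on the coordinate axes, and they are precisely: (i) $(\pm r_x^*,0,0)$, where $r_x^*$ is the unique positive solution of $\lambda_2-\frac1{r^3}+\frac{3c}{r^5}=0$; (ii) $(0,\pm r_y^*,0)$, where $r_y^*$ is the unique positive solution of $\lambda_1-\frac1{r^3}+\frac{3c}{r^5}=0$; (iii) $(0,0,\pm r_z^* )$, where $r_z^*$ is the unique positive solution of $-r^5-r^2-6c=0$. In particular the system has exactly $6$ equilibrium points.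
   Context: The Hill four-body problem with oblate tertiary (in rotated coordinates) is the system $\ddot x-2\dot y=\Omega_x$, $\ddot y+2\dot x=\Omega_y$, $\ddot z=\Omega_z$ with effective potential $$\Omega(x,y,z)=\tfrac12(\lambda_2x^2+\lambda_1y^2-z^2)+\frac1{r}-\frac{c}{r^3}+\frac{3cz^2}{r^5},\qquad r=(x^2+y^2+z^2)^{1/2}.$$ Here $\mu=m_2/(m_1+m_2)$, $c=m_3^{-2/3}R_3^2C_{20}/2<0$ where $R_3$ is the average radius of the oblate body $m_3$ and $C_{20}<0$ its zonal harmonic coefficient, and $v=(1-\tfrac32R_3^2C_{20})^{-1/3}=(1-3m_3^{2/3}c)^{-1/3}$. *)

(* Defs.v *)
From Stdlib Require Import Reals List.
From Coquelicot Require Import Coquelicot.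
Local Open Scope R_scope.

(* [Rpower] is the real power exp (y * ln x), meaningful for x > 0: here m3 > 0,
   and the outer base exceeds 1 because c < 0. *)
Definition vpar (m3 c : R) : R :=
  Rpower (1 - 3 * Rpower m3 (2 / 3) * c) (- (1 / 3)).

Definition lambda1 (mu v : R) : R :=
  3 / 2 * (1 - sqrt (1 - v ^ 2 * (4 - v ^ 2) * (mu - mu ^ 2))).

Definition lambda2 (mu v : R) : R :=
  3 / 2 * (1 + sqrt (1 - v ^ 2 * (4 - v ^ 2) * (mu - mu ^ 2))).

Definition radius (x y z : R) : R := sqrt (x ^ 2 + y ^ 2 + z ^ 2).

(* Division is total, so this also has a (meaningless) value at the origin;
   [equilibrium] excludes that point. *)
Definition Omega (l1 l2 c x y z : R) : R :=
  1 / 2 * (l2 * x ^ 2 + l1 * y ^ 2 - z ^ 2)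
  + 1 / radius x y z
  - c / radius x y z ^ 3
  + 3 * c * z ^ 2 / radius x y z ^ 5.

Definition equilibrium (l1 l2 c : R) (p : R * R * R) : Prop :=
  let '(x, y, z) := p in
  (x, y, z) <> (0, 0, 0) /\
  is_derive (fun s : R => Omega l1 l2 c s y z) x 0 /\
  is_derive (fun s : R => Omega l1 l2 c x s z) y 0 /\
  is_derive (fun s : R => Omega l1 l2 c x y s) z 0.

Definition on_coordinate_axis (p : R * R * R) : Prop :=
  let '(x, y, z) := p in
  (y = 0 /\ z = 0) \/ (x = 0 /\ z = 0) \/ (x = 0 /\ y = 0).

(* Main.v *)
Require Import Defs.
From Stdlib Require Import Reals List Lra.
From Coquelicot Require Import Coquelicot.
Local Open Scope R_scope.

(** Each partial derivative of [Omega] is a coordinate times a function of [r] and [z].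
If [x] (or [y]) and [z] are both nonzero, subtracting the two remaining factors gives
[lambda + 1 - 6 c / r^5 = 0], impossible for [c < 0 < lambda]. If [x] and [y] are both
nonzero, the same subtraction gives [lambda1 = lambda2], whereas [0 < v < 1] makes
the discriminant positive. On each axis the remaining equation is strictly monotone in
[r > 0], hence has a single positive root. *)

(** * The radius and the gradient of the potential *)

Lemma radius_gt0 (x y z : R) : (x, y, z) <> (0, 0, 0) -> 0 < radius x y z.
Proof.
intros H; apply sqrt_lt_R0.
destruct (Req_dec x 0) as [->|hx]; [|assert (0 < x ^ 2) by (apply pow2_gt_0; auto); nra].
destruct (Req_dec y 0) as [->|hy]; [|assert (0 < y ^ 2) by (apply pow2_gt_0; auto); nra].
destruct (Req_dec z 0) as [->|hz]; [easy|assert (0 < z ^ 2) by (apply pow2_gt_0; auto); nra].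
Qed.

Lemma pow2_radius (x y z : R) : radius x y z ^ 2 = x ^ 2 + y ^ 2 + z ^ 2.
Proof. apply pow2_sqrt; nra. Qed.

Lemma radius_axis (x : R) :
  radius x 0 0 = Rabs x /\ radius 0 x 0 = Rabs x /\ radius 0 0 x = Rabs x.
Proof.
rewrite <- (sqrt_Rsqr_abs x); unfold radius, Rsqr.
repeat split; f_equal; ring.
Qed.

(* [auto_derive] leaves eta-expanded derivatives, which [is_derive_unique] does not rewrite. *)
Lemma Derive_path (f : R -> R) (df t : R) :
  is_derive f t df -> Derive (fun s : R => f s) t = df.
Proof. apply is_derive_unique. Qed.

Lemma is_derive_radius_path (f g h : R -> R) (df dg dh t : R) :
  is_derive f t df -> is_derive g t dg -> is_derive h t dh ->
  0 < radius (f t) (g t) (h t) ->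
  is_derive (fun s => radius (f s) (g s) (h s)) t
    ((f t * df + g t * dg + h t * dh) / radius (f t) (g t) (h t)).
Proof.
intros Hf Hg Hh Hr.
assert (Hq : 0 < f t ^ 2 + g t ^ 2 + h t ^ 2)
  by (rewrite <- pow2_radius; apply pow_lt; exact Hr).
unfold radius in *.
auto_derive.
- repeat split; try (eexists; eassumption); simpl in *; lra.
- rewrite (Derive_path f df t Hf), (Derive_path g dg t Hg), (Derive_path h dh t Hh).
  replace (f t * (f t * 1) + g t * (g t * 1) + h t * (h t * 1))
    with (f t ^ 2 + g t ^ 2 + h t ^ 2) by ring.
  field; lra.
Qed.

(** A single chain rule along a curve covers all three partial derivatives: one coordinate is taken
    to be the identity and the other two constant. *)
Lemma is_derive_Omega_path (l1 l2 c : R) (f g h : R -> R) (df dg dh t : R) :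
  is_derive f t df -> is_derive g t dg -> is_derive h t dh ->
  0 < radius (f t) (g t) (h t) ->
  let r := radius (f t) (g t) (h t) in
  let u := - 1 / r ^ 3 + 3 * c / r ^ 5 - 15 * c * h t ^ 2 / r ^ 7 in
  is_derive (fun s => Omega l1 l2 c (f s) (g s) (h s)) t
    (f t * (l2 + u) * df + g t * (l1 + u) * dg
     + h t * (-1 + u + 6 * c / r ^ 5) * dh).
Proof.
intros Hf Hg Hh Hr r u.
unfold Omega.
set (rho := fun s => radius (f s) (g s) (h s)).
assert (Hd : is_derive rho t ((f t * df + g t * dg + h t * dh) / r))
  by now apply is_derive_radius_path.
(* The radius is made an opaque function [rho], known only through its value and derivative at [t],
   so the computation never sees the square root. *)
apply is_derive_ext with (f := fun s =>
  1 / 2 * (l2 * f s ^ 2 + l1 * g s ^ 2 - h s ^ 2)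
  + 1 / rho s - c / rho s ^ 3 + 3 * c * h s ^ 2 / rho s ^ 5); [reflexivity|].
assert (HR : rho t = r) by reflexivity.
fold r in Hr; clearbody rho.
auto_derive.
- rewrite HR; repeat split; try (eexists; eassumption);
    try apply (pow_nonzero r 3); try apply (pow_nonzero r 5); lra.
- rewrite (Derive_path f df t Hf), (Derive_path g dg t Hg), (Derive_path h dh t Hh),
    (Derive_path rho _ t Hd), HR.
  unfold u; field; lra.
Qed.

Lemma equilibriumE (l1 l2 c x y z : R) :
  let r := radius x y z in
  let u := - 1 / r ^ 3 + 3 * c / r ^ 5 - 15 * c * z ^ 2 / r ^ 7 in
  equilibrium l1 l2 c (x, y, z) <->
  (x, y, z) <> (0, 0, 0) /\ x * (l2 + u) = 0 /\ y * (l1 + u) = 0 /\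
  z * (-1 + u + 6 * c / r ^ 5) = 0.
Proof.
intros r u; unfold equilibrium.
(* Uniqueness of the derivative turns a vanishing partial derivative into the vanishing of its
   closed form. *)
assert (Hiff : forall (F : R -> R) (t d e : R),
  is_derive F t d -> d = e -> (is_derive F t 0 <-> e = 0)).
{ intros F t d e HF <-; split; intros H0; [|now rewrite <- H0].
  now rewrite <- (is_derive_unique F t d HF), <- (is_derive_unique F t 0 H0). }
assert (Hp : (x, y, z) <> (0, 0, 0) ->
  (is_derive (fun s => Omega l1 l2 c s y z) x 0 <-> x * (l2 + u) = 0) /\
  (is_derive (fun s => Omega l1 l2 c x s z) y 0 <-> y * (l1 + u) = 0) /\
  (is_derive (fun s => Omega l1 l2 c x y s) z 0 <->
     z * (-1 + u + 6 * c / r ^ 5) = 0)).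
{ intros H; apply radius_gt0 in H.
  assert (Hid : forall t : R, is_derive (fun s : R => s) t 1)
    by (intros t; auto_derive; auto).
  assert (Hk : forall k t : R, is_derive (fun _ : R => k) t 0)
    by (intros k t; auto_derive; auto).
  assert (Dx := is_derive_Omega_path l1 l2 c (fun s => s) (fun _ => y) (fun _ => z)
    1 0 0 x (Hid x) (Hk y x) (Hk z x) H).
  assert (Dy := is_derive_Omega_path l1 l2 c (fun _ => x) (fun s => s) (fun _ => z)
    0 1 0 y (Hk x y) (Hid y) (Hk z y) H).
  assert (Dz := is_derive_Omega_path l1 l2 c (fun _ => x) (fun _ => y) (fun s => s)
    0 0 1 z (Hk x z) (Hk y z) (Hid z) H).
  cbv beta zeta in Dx, Dy, Dz; fold r in Dx, Dy, Dz; fold u in Dx, Dy, Dz.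
  split; [|split]; (eapply Hiff; [eassumption|ring]). }
split; intros (H & H1 & H2 & H3); destruct (Hp H) as (E1 & E2 & E3); tauto.
Qed.

(** * Equilibria lie on the axes *)

Lemma equilibrium_on_axis (l1 l2 c : R) (p : R * R * R) :
  0 < l1 -> l1 < l2 -> c < 0 -> equilibrium l1 l2 c p -> on_coordinate_axis p.
Proof.
destruct p as [[x y] z]; intros hl1 hl hc; rewrite equilibriumE.
intros (Hn & Hx & Hy & Hz).
assert (Hr := radius_gt0 x y z Hn).
assert (Hw : 6 * c / radius x y z ^ 5 < 0).
{ apply Rdiv_neg_pos; [lra|apply pow_lt; exact Hr]. }
(* With [u] and [w] opaque, every off-axis case makes two of [l2 + u], [l1 + u], [-1 + u + w]
   vanish, a linear contradiction. *)
revert Hx Hy Hz Hw; generalize (6 * c / radius x y z ^ 5).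
generalize (- 1 / radius x y z ^ 3 + 3 * c / radius x y z ^ 5
            - 15 * c * z ^ 2 / radius x y z ^ 7).
intros u w Hx Hy Hz Hw; simpl.
apply Rmult_integral in Hx, Hy, Hz.
destruct Hx, Hy, Hz; try tauto; exfalso; lra.
Qed.

(** * Existence and uniqueness of the radii *)

Lemma horizontal_equation_poly (l c r : R) : 0 < r ->
  (l - 1 / r ^ 3 + 3 * c / r ^ 5 = 0 <-> l * r ^ 5 - r ^ 2 + 3 * c = 0).
Proof.
intros hr.
replace (l - 1 / r ^ 3 + 3 * c / r ^ 5)
  with ((l * r ^ 5 - r ^ 2 + 3 * c) / r ^ 5) by (field; lra).
assert (0 < r ^ 5) by (apply pow_lt; exact hr).
split; intros H1.
- apply Rmult_integral in H1; destruct H1 as [H1|H1]; [exact H1|].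
  apply Rinv_neq_0_compat in H1; [easy|lra].
- rewrite H1; unfold Rdiv; ring.
Qed.

Lemma pow_S_lt_compat (a b : R) (n : nat) : 0 < a -> a < b -> a ^ S n < b ^ S n.
Proof.
intros ha hab; induction n as [|n IH]; [simpl; lra|].
assert (0 < a ^ S n) by (apply pow_lt; exact ha).
change (a * a ^ S n < b * b ^ S n).
apply Rmult_le_0_lt_compat; lra.
Qed.

Lemma unique_horizontal_radius (l c : R) : 0 < l -> c < 0 ->
  exists r, unique (fun r => 0 < r /\ l - 1 / r ^ 3 + 3 * c / r ^ 5 = 0) r.
Proof.
intros hl hc.
set (M := 1 + (1 - 3 * c) / l).
assert (hM : l * M = l + 1 - 3 * c) by (unfold M; field; lra).
assert (hM1 : 1 < M).
{ unfold M; assert (0 < (1 - 3 * c) / l) by (apply Rdiv_pos_pos; lra); lra. }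
(* The cleared form is continuous at 0, where it equals [3 * c < 0]. With [q = M ^ 2 > 1], its value
   at [M] is [q * (q - 1) + (l - 3 * c) * (q ^ 2 - 1) + l > 0]. *)
destruct (IVT (fun r => l * r ^ 5 - r ^ 2 + 3 * c) 0 M) as [r [Hr0 Hr]].
- reg.
- lra.
- simpl; lra.
- assert (1 < M ^ 2) by nra.
  replace (l * M ^ 5) with (l * M * (M ^ 2) ^ 2) by ring.
  rewrite hM; generalize dependent (M ^ 2); intros q hq.
  assert (0 < (q - 1) * q) by nra.
  assert (0 < (l - 3 * c) * (q ^ 2 - 1)) by (apply Rmult_lt_0_compat; nra).
  nra.
- assert (hr : 0 < r).
  { destruct (Req_dec r 0) as [->|]; [simpl in Hr|]; lra. }
  exists r; split.
  + split; [|rewrite horizontal_equation_poly]; auto.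
  (* The cleared polynomial is not monotone on [r > 0]. Eliminating [l] between the equations of two
     roots [a < b] leaves a sum of two positive terms equal to 0. *)
  + assert (Hlt : forall a b, 0 < a -> a < b ->
      l * a ^ 5 - a ^ 2 + 3 * c = 0 -> l * b ^ 5 - b ^ 2 + 3 * c = 0 -> False).
    { intros a b ha hab Ea Eb.
      assert (h3 := pow_S_lt_compat a b 2 ha hab).
      assert (h5 := pow_S_lt_compat a b 4 ha hab).
      assert (hab2 : 0 < a ^ 2 * b ^ 2) by (apply Rmult_lt_0_compat; apply pow_lt; lra).
      assert (E : a ^ 2 * b ^ 2 * (b ^ 3 - a ^ 3) - 3 * c * (b ^ 5 - a ^ 5) = 0).
      { replace (a ^ 2 * b ^ 2 * (b ^ 3 - a ^ 3) - 3 * c * (b ^ 5 - a ^ 5))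
          with (a ^ 5 * (l * b ^ 5 - b ^ 2 + 3 * c)
                - b ^ 5 * (l * a ^ 5 - a ^ 2 + 3 * c)) by ring.
        rewrite Ea, Eb; ring. }
      nra. }
    intros s [hs Es]; rewrite horizontal_equation_poly in Es by exact hs.
    destruct (Rtotal_order r s) as [h|[h|h]]; [|exact h|]; exfalso; eauto.
Qed.

Lemma unique_vertical_radius (c : R) : c < 0 ->
  exists r, unique (fun r => 0 < r /\ - r ^ 5 - r ^ 2 - 6 * c = 0) r.
Proof.
intros hc.
(* The sign is flipped to get an increasing function. At [1 - 6 * c] its last two terms already sum
   to [1 - 6 * c + 36 * c ^ 2 > 0]. *)
destruct (IVT (fun r => r ^ 5 + r ^ 2 + 6 * c) 0 (1 - 6 * c)) as [r [Hr0 Hr]].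
- reg.
- lra.
- simpl; lra.
- assert (0 < (1 - 6 * c) ^ 5) by (apply pow_lt; lra).
  nra.
- assert (hr : 0 < r).
  { destruct (Req_dec r 0) as [->|]; [simpl in Hr|]; lra. }
  exists r; split; [split; lra|].
  assert (Hlt : forall a b, 0 < a -> a < b -> a ^ 5 + a ^ 2 < b ^ 5 + b ^ 2).
  { intros a b ha hab.
    apply Rplus_lt_compat; now apply pow_S_lt_compat. }
  intros s [hs Es].
  destruct (Rtotal_order r s) as [h|[h|h]]; [|exact h|]; exfalso;
    apply Hlt in h; lra.
Qed.

(** On an axis the radius is the absolute value of the coordinate, so each positive root yields a
    pair of opposite equilibria. *)
Lemma unique_Rabs (P : R -> Prop) (r x : R) :
  unique (fun s => 0 < s /\ P s) r ->
  (x <> 0 /\ P (Rabs x) <-> x = r \/ x = - r).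
Proof.
intros [[hr Pr] Hu]; split.
- intros [hx Px].
  rewrite (Hu (Rabs x)) by (split; [apply Rabs_pos_lt|]; assumption).
  unfold Rabs; destruct (Rcase_abs x); lra.
- intros [->| ->]; rewrite ?Rabs_Ropp, Rabs_pos_eq by lra; split; auto; lra.
Qed.

(** * Equilibria on each axis *)

Lemma equilibrium_x_axis (l1 l2 c x : R) :
  equilibrium l1 l2 c (x, 0, 0) <->
  x <> 0 /\ l2 - 1 / Rabs x ^ 3 + 3 * c / Rabs x ^ 5 = 0.
Proof.
rewrite equilibriumE, (proj1 (radius_axis x)).
unfold Rdiv; split.
- intros (Hn & Hx & _).
  assert (hx : x <> 0) by (intros ->; auto).
  split; [exact hx|].
  apply Rmult_integral in Hx; destruct Hx as [Hx|Hx]; [easy|lra].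
- intros [hx Ex].
  split; [congruence|]; repeat split; try ring.
  apply Rmult_eq_0_compat_l; etransitivity; [|exact Ex]; ring.
Qed.

Lemma equilibrium_y_axis (l1 l2 c y : R) :
  equilibrium l1 l2 c (0, y, 0) <->
  y <> 0 /\ l1 - 1 / Rabs y ^ 3 + 3 * c / Rabs y ^ 5 = 0.
Proof.
rewrite equilibriumE, (proj1 (proj2 (radius_axis y))).
unfold Rdiv; split.
- intros (Hn & _ & Hy & _).
  assert (hy : y <> 0) by (intros ->; auto).
  split; [exact hy|].
  apply Rmult_integral in Hy; destruct Hy as [Hy|Hy]; [easy|lra].
- intros [hy Ey].
  split; [congruence|]; repeat split; try ring.
  apply Rmult_eq_0_compat_l; etransitivity; [|exact Ey]; ring.
Qed.

Lemma equilibrium_z_axis (l1 l2 c z : R) :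
  equilibrium l1 l2 c (0, 0, z) <->
  z <> 0 /\ - Rabs z ^ 5 - Rabs z ^ 2 - 6 * c = 0.
Proof.
rewrite equilibriumE, (proj2 (proj2 (radius_axis z))).
rewrite <- (pow2_abs z).
(* On this axis [z ^ 2 = r ^ 2], so the terms in [c] combine as [3 - 15 + 6 = -6] over [r ^ 5]. *)
assert (E : z <> 0 ->
  -1 + (-1 / Rabs z ^ 3 + 3 * c / Rabs z ^ 5 - 15 * c * Rabs z ^ 2 / Rabs z ^ 7)
    + 6 * c / Rabs z ^ 5
  = (- Rabs z ^ 5 - Rabs z ^ 2 - 6 * c) * / Rabs z ^ 5).
{ intros hz; field; apply Rabs_no_R0; exact hz. }
split.
- intros (Hn & _ & _ & Hz).
  assert (hz : z <> 0) by (intros ->; auto).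
  split; [exact hz|].
  rewrite (E hz) in Hz.
  apply Rmult_integral in Hz; destruct Hz as [Hz|Hz]; [easy|].
  apply Rmult_integral in Hz; destruct Hz as [Hz|Hz]; [exact Hz|].
  exfalso; revert Hz.
  apply Rinv_neq_0_compat, pow_nonzero, Rabs_no_R0, hz.
- intros [hz Ez].
  split; [congruence|]; repeat split; try ring.
  rewrite (E hz), Ez; ring.
Qed.

Lemma equilibrium_iff (l1 l2 c rx ry rz : R) (p : R * R * R) :
  0 < l1 -> l1 < l2 -> c < 0 ->
  unique (fun r => 0 < r /\ l2 - 1 / r ^ 3 + 3 * c / r ^ 5 = 0) rx ->
  unique (fun r => 0 < r /\ l1 - 1 / r ^ 3 + 3 * c / r ^ 5 = 0) ry ->
  unique (fun r => 0 < r /\ - r ^ 5 - r ^ 2 - 6 * c = 0) rz ->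
  equilibrium l1 l2 c p <->
  (p = (rx, 0, 0) \/ p = (- rx, 0, 0) \/
   p = (0, ry, 0) \/ p = (0, - ry, 0) \/
   p = (0, 0, rz) \/ p = (0, 0, - rz)).
Proof.
intros hl1 hl hc Hx Hy Hz.
assert (Ex : forall x, equilibrium l1 l2 c (x, 0, 0) <-> x = rx \/ x = - rx)
  by (intros x; rewrite equilibrium_x_axis; apply (unique_Rabs _ _ _ Hx)).
assert (Ey : forall y, equilibrium l1 l2 c (0, y, 0) <-> y = ry \/ y = - ry)
  by (intros y; rewrite equilibrium_y_axis; apply (unique_Rabs _ _ _ Hy)).
assert (Ez : forall z, equilibrium l1 l2 c (0, 0, z) <-> z = rz \/ z = - rz)
  by (intros z; rewrite equilibrium_z_axis; apply (unique_Rabs _ _ _ Hz)).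
split.
- intros Hp; assert (Ha := equilibrium_on_axis _ _ _ _ hl1 hl hc Hp).
  destruct p as [[x y] z]; destruct Ha as [[-> ->]|[[-> ->]|[-> ->]]].
  + apply Ex in Hp; destruct Hp as [->| ->]; tauto.
  + apply Ey in Hp; destruct Hp as [->| ->]; tauto.
  + apply Ez in Hp; destruct Hp as [->| ->]; tauto.
- intros [->|[->|[->|[->|[->| ->]]]]];
    first [apply Ex; tauto|apply Ey; tauto|apply Ez; tauto].
Qed.

(** * Parameter bounds and the count *)

Lemma vpar_bounds (m3 c : R) : c < 0 -> 0 < vpar m3 c < 1.
Proof.
intros hc; split; unfold vpar; [apply exp_pos|].
assert (0 < Rpower m3 (2 / 3)) by apply exp_pos.
set (b := 1 - 3 * Rpower m3 (2 / 3) * c).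
assert (hb : 1 < b) by (unfold b; nra).
apply Rlt_le_trans with (Rpower b 0).
- apply Rpower_lt; lra.
- rewrite Rpower_O; lra.
Qed.

Lemma lambda_bounds (mu v : R) : 0 < mu -> mu <= 1 / 2 -> 0 < v < 1 ->
  0 < lambda1 mu v /\ lambda1 mu v < lambda2 mu v.
Proof.
intros hmu0 hmu1 hv; unfold lambda1, lambda2.
set (D := 1 - v ^ 2 * (4 - v ^ 2) * (mu - mu ^ 2)).
assert (hv2 : 0 < v ^ 2 < 1) by (split; nra).
(* With [q = v ^ 2] in (0, 1), [3 - q * (4 - q) = (1 - q) * (3 - q) > 0]. Together with
   [mu - mu ^ 2 <= 1 / 4] this keeps [D] positive. *)
assert (hw : 0 < v ^ 2 * (4 - v ^ 2) < 3) by (split; nra).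
assert (hm : 0 < mu - mu ^ 2 <= 1 / 4) by (split; nra).
assert (hD : 0 < D < 1) by (unfold D; split; nra).
assert (0 < sqrt D) by (apply sqrt_lt_R0; lra).
assert (sqrt D < 1) by (rewrite <- sqrt_1; apply sqrt_lt_1; lra).
lra.
Qed.

Theorem mainTheorem5 (mu m3 c : R)
  (hmu0 : 0 < mu) (hmu1 : mu <= 1 / 2) (hm3 : 0 < m3) (hc : c < 0) :
  let v := vpar m3 c in
  let l1 := lambda1 mu v in
  let l2 := lambda2 mu v in
  (forall p : R * R * R, equilibrium l1 l2 c p -> on_coordinate_axis p) /\
  (exists rx ry rz : R,
     unique (fun r : R => 0 < r /\ l2 - 1 / r ^ 3 + 3 * c / r ^ 5 = 0) rx /\
     unique (fun r : R => 0 < r /\ l1 - 1 / r ^ 3 + 3 * c / r ^ 5 = 0) ry /\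
     unique (fun r : R => 0 < r /\ - r ^ 5 - r ^ 2 - 6 * c = 0) rz /\
     forall p : R * R * R,
       equilibrium l1 l2 c p <->
       (p = (rx, 0, 0) \/ p = (- rx, 0, 0) \/
        p = (0, ry, 0) \/ p = (0, - ry, 0) \/
        p = (0, 0, rz) \/ p = (0, 0, - rz))) /\
  (exists L : list (R * R * R),
     NoDup L /\ length L = 6%nat /\
     forall p : R * R * R, In p L <-> equilibrium l1 l2 c p).
Proof.
intros v l1 l2.
destruct (lambda_bounds mu v hmu0 hmu1 (vpar_bounds m3 c hc)) as [hl1 hl].
fold l1 l2 in hl1, hl.
destruct (unique_horizontal_radius l2 c) as [rx Hx]; [lra..|].
destruct (unique_horizontal_radius l1 c) as [ry Hy]; [lra..|].
destruct (unique_vertical_radius c hc) as [rz Hz].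
assert (Hp := fun p => equilibrium_iff l1 l2 c rx ry rz p hl1 hl hc Hx Hy Hz).
split; [intros p; now apply equilibrium_on_axis|split].
- exists rx, ry, rz; auto.
- exists ((rx, 0, 0) :: (- rx, 0, 0) :: (0, ry, 0) :: (0, - ry, 0)
          :: (0, 0, rz) :: (0, 0, - rz) :: nil).
  split; [|split; [reflexivity|]].
  + destruct Hx as [[hx _] _], Hy as [[hy _] _], Hz as [[hz _] _].
    (* Any coincidence in the list would force some positive radius to be 0 or equal to its own
       negative. *)
    repeat constructor; simpl; intros H;
      repeat (destruct H as [H|H]; [injection H; intros; lra|]); exact H.
  + intros p; rewrite Hp; simpl; intuition congruence.
Qed.
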